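(* Let $p\ge0$ be an integer, and let $\{\varphi_j\}_{j=0}^p\subset\mathcal P_p$ (linearly independent) and $\{\lambda_j\}_{j=0}^p\subset\mathbb R_{>0}$ be eigenfunctions and eigenvalues satisfying $$\lambda_j\int_{-1}^1(\mathcal I\varphi_j)'(\mathcal I v)'\,\mathrm ds=\int_{-1}^1\varphi_j\,v\,\mathrm ds\quad\forall\,v\in\mathcal P_p,\ j=0,\dots,p,$$ normalized by $\int_{-1}^1(\mathcal I\varphi_j)'(\mathcal I\varphi_k)'\,\mathrm ds=\delta_{jk}$ for all $0\le j,k\le p$. Let $\mathsf V$ be a finite dimensional real vector space with a basis, with inner products $(\cdot,\cdot)_M$ and $(\cdot,\cdot)_A$ represented by arbitrary symmetric positive definite matrices $M$ and $A$, and let $\tau>0$. Let $\mathbf L$ be the matrix representing the bilinear form $\mathcal L$ (defined in the context) in the basis $\{\varphi_j\}_{j=0}^p$ of $\mathcal V_p$, and let $\mathbf H$ be the block-diagonal matrix $$\mathbf H:=\operatorname{diag}\left\{\Big(M+\tfrac{\tau\sqrt{\lambda_j}}{2}A\Big)A^{-1}\Big(M+\tfrac{\tau\sqrt{\lambda_j}}{2}A\Big)\right\}_{j=0}^p .$$ Then $$\frac12\le\frac{\mathbf v^\top\mathbf L\,\mathbf v}{\mathbf v^\top\mathbf H\,\mathbf v}\le 2\qquad\forall\,\mathbf v\in\mathsf V^{p+1}\setminus\{0\}.$$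
   Context: Let $\{\mathsf e_i\}_{i=1}^{\dim\mathsf V}$ be the given basis of $\mathsf V$; $M_{ij}=(\mathsf e_i,\mathsf e_j)_M$, $A_{ij}=(\mathsf e_i,\mathsf e_j)_A$. Elements of $\mathsf V$ are identified with their coordinate vectors, so that matrices such as $A^{-1}M$ act on $\mathsf V$. $\mathcal P_p$ is the space of real polynomials in one real variable of degree at most $p$, and $\mathcal V_p$ is the space of $\mathsf V$-valued polynomials of one real variable of degree at most $p$. Linear operators on $\mathsf V$ act on $\mathcal V_p$ coefficient-wise, and linear operators $\pi$ on $\mathcal P_p$ act on $v=\sum_j\mathsf v_j\phi_j\in\mathcal V_p$ (with $\mathsf v_j\in\mathsf V$ and $\{\phi_j\}_{j=0}^p$ a basis of $\mathcal P_p$) by $\pi v=\sum_j\mathsf v_j(\pi\phi_j)$; in particular $v'=\sum_j \mathsf v_j\phi_j'$. $L_k$ denotes the Legendre polynomial of degree $k$ on $(-1,1)$, normalized so that $L_k(1)=1$. The reconstruction operator $\mathcal I\colon\mathcal P_p\to\mathcal P_{p+1}$ is $$\mathcal I v:=v-v(-1)\,\frac{(-1)^p(L_p-L_{p+1})}{2},$$ extended to $\mathcal I\colon\mathcal V_p\to\mathcal V_{p+1}$ by $\mathcal I v:=\sum_{j=0}^p\mathsf v_j\,(\mathcal I\phi_j)$ for $v=\sum_{j=0}^p\mathsf v_j\phi_j\in\mathcal V_p$. The form $(u,v)\mapsto\int_{-1}^1(\mathcal I u)'(\mathcal I v)'\,\mathrm ds$ is an inner product on $\mathcal P_p$, so eigenpairs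 as in the claim exist, with positive eigenvalues, and $\{\varphi_j\}_{j=0}^p$ is a basis of $\mathcal P_p$. Define $$\mathcal B(u,v):=\int_{-1}^1(u',v)_M\,\mathrm ds+(u(-1),v(-1))_M+\frac{\tau}{2}\int_{-1}^1(u,v)_A\,\mathrm ds,\qquad Pv:=A^{-1}M(\mathcal I v)'+\frac{\tau}{2}v,$$ and $\mathcal L(u,v):=\mathcal B(u,Pv)$ for $u,v\in\mathcal V_p$. ''$\mathbf L$ represents $\mathcal L$ in the basis $\{\varphi_j\}_{j=0}^p$'' means that $\mathbf L$ is the matrix (of $(p+1)\times(p+1)$ blocks of size $\dim\mathsf V\times\dim\mathsf V$) such that $\mathcal L(u,v)=\mathbf v^\top\mathbf L\,\mathbf u$ for all $u=\sum_{j=0}^p\mathsf u_j\varphi_j$, $v=\sum_{j=0}^p\mathsf v_j\varphi_j$ in $\mathcal V_p$, where $\mathbf u=(\mathsf u_0,\dots,\mathsf u_p)$ and $\mathbf v=(\mathsf v_0,\dots,\mathsf v_p)$ in $\mathsf V^{p+1}$. *)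

(* Defs.v *)
From HB Require Import structures.
From mathcomp Require Import all_boot all_order all_algebra.
From mathcomp Require Import all_classical all_reals all_analysis.
From mathcomp Require Import ring lra.
Import Order.TTheory GRing.Theory Num.Theory.
Import numFieldNormedType.Exports.

Set Implicit Arguments.
Unset Strict Implicit.
Unset Printing Implicit Defensive.

Local Open Scope classical_set_scope.
Local Open Scope ring_scope.

Section Scalar.
Variable R : realType.

Definition int11 (f : R -> R) : R :=
  \int[lebesgue_measure]_(s in `[(-1)%R, 1%R]) f s.

(* Rodrigues' formula; [size_legendre], [legendre1] and [legendre_ortho] below
   are the properties that characterize the Legendre polynomials. *)
Definition legendre (k : nat) : {poly R} :=
  (2 ^+ k * k`!%:R)^-1 *: derivn k (('X ^+ 2 - 1) ^+ k).

Lemma legendre_sub_derivn (a : R) (h : {poly R}) (k j : nat) : (j <= k)%N ->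
  exists r : {poly R}, derivn j (('X - a%:P) ^+ k * h) =
    ('X - a%:P) ^+ (k - j) * ((k ^_ j)%:R *: h + ('X - a%:P) * r).
Proof.
elim: j => [|j IH] jk.
  by exists 0; rewrite subn0 ffactn0 scale1r mulr0 addr0 derivn0.
have [r] := IH (ltnW jk); rewrite derivnS => ->.
have -> : (k - j = (k - j.+1).+1)%N by rewrite -subSn.
set m := (k - j.+1)%N; set c := (k ^_ j)%:R : R.
exists (c *: deriv h + (m.+2)%:R *: r + ('X - a%:P) * deriv r).
have dX : deriv ('X - a%:P) = 1 by rewrite derivB derivX derivC subr0.
rewrite derivM deriv_exp dX derivD poly.derivZ derivM dX !mul1r /= -mulr_natl.
have -> : (k ^_ j.+1)%:R = c * m.+1%:R :> R.
  by rewrite ffactnSr natrM /m -subSn ?subSS.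
rewrite exprS -!mul_polyC !rmorphM /= !polyC_natr -/c.
rewrite -[m.+2]addn2 -[m.+1]addn1 !natrD.
by ring.
Qed.

Lemma legendre_factor (k : nat) :
  ('X ^+ 2 - 1) ^+ k = ('X - 1%:P) ^+ k * ('X - (-1)%:P) ^+ k :> {poly R}.
Proof. by rewrite -exprMn; congr (_ ^+ k); rewrite polyCN; ring. Qed.

Lemma legendre1 (k : nat) : (legendre k).[1] = 1.
Proof.
rewrite /legendre legendre_factor.
have [r ->] := legendre_sub_derivn 1 (('X - (-1)%:P) ^+ k) (leqnn k).
rewrite subnn expr0 mul1r ffactnn !hornerE opprK.
by rewrite subrr mul0r addr0 -[1 + 1]/2 [_ * 2 ^+ k]mulrC mulVf.
Qed.

Lemma size_legendre (k : nat) : size (legendre k) = k.+1.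
Proof.
set f : {poly R} := ('X ^+ 2 - 1) ^+ k.
have m : f \is monic by rewrite monic_exp // monicXnsubC.
have sf : size f = (k + k).+1.
  have s2 : size ('X ^+ 2 - 1 : {poly R}) = 3%N by rewrite size_XnsubC.
  have := size_exp ('X ^+ 2 - 1 : {poly R}) k; rewrite s2 -/f /= => e.
  have : size f != 0%N by rewrite size_poly_eq0 monic_neq0.
  by move: e; case: (size f) => //= s -> _; rewrite mul2n addnn.
rewrite size_scale ?invr_eq0 ?mulf_neq0 ?expf_neq0 ?pnatr_eq0
  -?lt0n ?fact_gt0 //.
apply/anti_leq/andP; split.
  apply/leq_sizeP => j kj; rewrite coef_derivn -/f nth_default ?mul0rn //.
  by rewrite sf ltn_add2l.
rewrite ltnNge; apply/negP => /leq_sizeP /(_ k (leqnn k)) /eqP.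
rewrite coef_derivn -/f.
have -> : f`_(k + k) = 1 by move/monicP: m; rewrite lead_coefE sf.
by rewrite pnatr_eq0 eqn0Ngt ffact_gt0 leq_addr.
Qed.

Lemma int11_deriv (q : {poly R}) :
  int11 (fun s => (deriv q).[s]) = q.[1] - q.[-1].
Proof.
rewrite /int11 /Rintegral.
rewrite (@continuous_FTC2 R (fun s => (deriv q).[s]) (fun s => q.[s]) (-1) 1) //.
- by apply: continuous_subspaceT => x; apply: continuous_horner.
- split.
  + by move=> x _; exact: derivable_horner.
  + by apply: cvg_at_right_filter; apply: continuous_horner.
  + by apply: cvg_at_left_filter; apply: continuous_horner.
- by move=> x _; rewrite derivE.
Qed.

Lemma legendre_ortho (k : nat) (q : {poly R}) : (size q <= k)%N ->
  int11 (fun s => (legendre k * q).[s]) = 0.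
Proof.
set f : {poly R} := ('X ^+ 2 - 1) ^+ k => sq.
have vanish j : (j < k)%N -> (derivn j f).[1] = 0 /\ (derivn j f).[-1] = 0.
  move=> jk; rewrite /f legendre_factor; split.
    have [r ->] := legendre_sub_derivn 1 (('X - (-1)%:P) ^+ k) (ltnW jk).
    by rewrite -(subnSK jk) exprS !hornerE subrr !mul0r.
  rewrite mulrC.
  have [r ->] := legendre_sub_derivn (-1) (('X - 1%:P) ^+ k) (ltnW jk).
  by rewrite -(subnSK jk) exprS !hornerE subrr !mul0r.
have prim j : (j <= k)%N -> forall q : {poly R}, (size q <= j)%N ->
    exists2 g, deriv g = derivn j f * q & g.[1] = g.[-1].
  elim: j => [|j IH] jk {sq}q sq.
    move: sq; rewrite leqn0 size_poly_eq0 => /eqP ->.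
    by exists 0; rewrite ?poly.deriv0 ?mulr0 ?hornerE.
  have sq' : (size (deriv q) <= j)%N.
    have [->|q0] := eqVneq q 0; first by rewrite deriv0 size_poly0.
    by rewrite -ltnS (leq_trans _ sq) // lt_size_deriv.
  have [g dg g1] := IH (ltnW jk) _ sq'.
  exists (derivn j f * q - g).
    by rewrite derivB derivM dg derivnS addrK.
  by have [e1 e2] := vanish j jk; rewrite !hornerE e1 e2 g1 !mul0r.
have [g dg g1] := prim k (leqnn k) q sq.
have -> : legendre k * q = deriv ((2 ^+ k * k`!%:R)^-1 *: g).
  by rewrite poly.derivZ dg -scalerAl.
by rewrite int11_deriv !hornerE g1 subrr.
Qed.

Definition recon (p : nat) (v : {poly R}) : {poly R} :=
  v - v.[-1] *: (((-1) ^+ p / 2) *: (legendre p - legendre p.+1)).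

Definition recon_ip (p : nat) (u v : {poly R}) : R :=
  int11 (fun s => (deriv (recon p u)).[s] * (deriv (recon p v)).[s]).

End Scalar.

Section Vectorial.
Variables (R : realType) (n : nat).

Definition spd (X : 'M[R]_n) : Prop :=
  X^T = X /\ forall x : 'cV[R]_n, x != 0 -> 0 < (x^T *m X *m x) 0 0.

Definition ip (X : 'M[R]_n) (x y : 'cV[R]_n) : R := (x^T *m X *m y) 0 0.

(* With V = 'cV[R]_n, a V-valued polynomial is the column of its coordinate
   polynomials, so an operator on scalar polynomials acts entrywise
   ([map_mx_vcomb]). *)
Definition vpoly := 'cV[{poly R}]_n.
Implicit Types (u v : vpoly).

Definition veval v (s : R) : 'cV[R]_n := map_mx (fun q : {poly R} => q.[s]) v.

Definition vderiv v : vpoly := map_mx (@deriv R) v.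

Definition vrecon (p : nat) v : vpoly := map_mx (@recon R p) v.

Definition mxact (X : 'M[R]_n) v : vpoly := map_mx (@polyC R) X *m v.

Definition vcomb (p : nat) (phi : 'I_p.+1 -> {poly R})
    (x : 'I_p.+1 -> 'cV[R]_n) : vpoly :=
  \sum_j map_mx (fun c : R => c *: phi j) (x j).

Variables (p : nat) (M A : 'M[R]_n) (tau : R).

Definition Bform u v : R :=
  int11 (fun s => ip M (veval (vderiv u) s) (veval v s))
  + ip M (veval u (-1)) (veval v (-1))
  + tau / 2 * int11 (fun s => ip A (veval u s) (veval v s)).

Definition Pop v : vpoly :=
  mxact (invmx A *m M) (vderiv (vrecon p v)) + (tau / 2)%:P *: v.

Definition Lform u v : R := Bform u (Pop v).

Definition represents (phi : 'I_p.+1 -> {poly R})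
    (L : 'M[R]_(\sum_(j < p.+1) n)) : Prop :=
  forall x y : 'I_p.+1 -> 'cV[R]_n,
    Lform (vcomb phi x) (vcomb phi y)
    = ((\mxcol_(j < p.+1) y j)^T *m L *m \mxcol_(j < p.+1) x j) 0 0.

Definition Hmx (lam : 'I_p.+1 -> R) : 'M[R]_(\sum_(j < p.+1) n) :=
  \mxdiag_(j < p.+1)
    ((M + (tau * Num.sqrt (lam j) / 2) *: A) *m invmx A
      *m (M + (tau * Num.sqrt (lam j) / 2) *: A)).

End Vectorial.

Lemma map_mx_vcomb (R : realType) (n p : nat) (pi : {linear {poly R} -> {poly R}})
    (phi : 'I_p.+1 -> {poly R}) (x : 'I_p.+1 -> 'cV[R]_n) :
  map_mx pi (vcomb phi x) = vcomb (pi \o phi) x.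
Proof.
apply/matrixP => i j; rewrite mxE /vcomb !summxE linear_sum.
by apply: eq_bigr => k _; rewrite !mxE linearZ.
Qed.

Lemma recon_is_linear (R : realType) (p : nat) : linear (@recon R p).
Proof.
move=> a u v; rewrite /recon; set w := ((-1) ^+ p / 2) *: _.
by rewrite hornerD hornerZ scalerDl scalerBr -[(a * _) *: w]scalerA opprD addrACA.
Qed.

HB.instance Definition _ (R : realType) (p : nat) :=
  GRing.isLinear.Build R {poly R} {poly R} _ (@recon R p)
    (@recon_is_linear R p).

(* Main.v *)
(** On [P_p], the boundary term in [B] turns [u'] into [(I u)'], because
    [I u - u] is orthogonal to polynomials of degree less than [p], [I u] has the
    boundary value of [u] at 1 and vanishes at -1. With [w = (I v)'] this gives
      [L(v, v) = int |w|^2_(M A^-1 M) + tau int (w, v)_M + tau^2/4 int |v|^2_A].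
    Let [E] be the sum of the first and last terms; in the eigenbasis, [E] is the
    value of the first and last terms of [H]. The middle term of [L] is
    nonnegative, since it equals [tau/2 (|v(1)|^2_M + |v(-1)|^2_M)], and is at
    most [E] by Young's inequality; the same two bounds hold blockwise for the
    middle term of [H]. So both forms lie between [E] and [2 E]. *)
Require Import Defs.
From HB Require Import structures.
From mathcomp Require Import all_boot all_order all_algebra.
From mathcomp Require Import all_classical all_reals all_analysis.
From mathcomp Require Import ring lra.
Import Order.TTheory GRing.Theory Num.Theory.
Import numFieldNormedType.Exports.

Set Implicit Arguments.
Unset Strict Implicit.
Unset Printing Implicit Defensive.

Local Open Scope ring_scope.

(** * Integration over [-1, 1] as a linear functional on polynomials *)

Definition polyint (R : realType) (q : {poly R}) : R := int11 (fun s => q.[s]).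

Lemma horner_integrable (R : realType) (q : {poly R}) :
  (@lebesgue_measure R).-integrable `[(-1)%R, 1%R]%classic
    (EFin \o (fun s => q.[s])).
Proof.
apply: continuous_compact_integrable; first exact: segment_compact.
by apply: continuous_subspaceT => x; apply: continuous_horner.
Qed.

Lemma polyint_is_linear (R : realType) : linear (@polyint R).
Proof.
move=> a p q; rewrite /polyint /int11.
have -> : (fun s => (a *: p + q).[s]) = (fun s => (a *: p).[s] + q.[s]).
  by apply/funext => s; rewrite hornerD.
rewrite RintegralD //; try exact: horner_integrable.
have -> : (fun s => (a *: p).[s]) = (fun s => a * p.[s]).
  by apply/funext => s; rewrite hornerZ.
by rewrite RintegralZl //; exact: horner_integrable.
Qed.

HB.instance Definition _ (R : realType) :=
  GRing.isLinear.Build R {poly R} R _ (@polyint R) (@polyint_is_linear R).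

Lemma polyintZ (R : realType) (a : R) (q : {poly R}) :
  polyint (a *: q) = a * polyint q.
Proof. exact: linearZ. Qed.

Lemma polyintD (R : realType) (p q : {poly R}) :
  polyint (p + q) = polyint p + polyint q.
Proof. exact: linearD. Qed.

Lemma polyint_ge0 (R : realType) (q : {poly R}) :
  (forall s, 0 <= q.[s]) -> 0 <= polyint q.
Proof. by move=> q0; rewrite /polyint /int11; apply: Rintegral_ge0 => s _. Qed.

(** * Boundary values, degree and weak derivative of the reconstruction *)

Lemma legendreN1 (R : realType) (k : nat) : (legendre R k).[-1] = (-1) ^+ k.
Proof.
rewrite /legendre legendre_factor [('X - _) ^+ k * _]mulrC.
(* At -1 only the term with all [k] derivatives on [(X + 1)^k] survives; it is [k! (X - 1)^k], hence
   the factor [(-2)^k]. *)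
have [r ->] := legendre_sub_derivn (-1 : R) (('X - 1%:P) ^+ k) (leqnn k).
rewrite subnn expr0 mul1r ffactnn !hornerE.
have -> : -1 - 1 = -1 * 2 :> R by ring.
rewrite exprMn; field.
by rewrite expf_neq0 // pnatr_eq0 -lt0n fact_gt0.
Qed.

Lemma recon1 (R : realType) (p : nat) (v : {poly R}) :
  (recon p v).[1] = v.[1].
Proof.
rewrite /recon hornerD hornerN 2!hornerZ hornerD hornerN !legendre1.
by rewrite subrr !mulr0 subr0.
Qed.

(** The factor [(-1)^p / 2] gives the correction the value 1 at -1, where [L_p - L_(p+1)] equals
    [2 (-1)^p]. *)
Lemma reconN1 (R : realType) (p : nat) (v : {poly R}) : (recon p v).[-1] = 0.
Proof.
rewrite /recon hornerD hornerN 2!hornerZ hornerD hornerN !legendreN1 exprS.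
have -> : (-1) ^+ p / 2 * ((-1) ^+ p - -1 * (-1) ^+ p) = ((-1) ^+ p) ^+ 2 :> R.
  by field.
by rewrite sqrr_sign mulr1 subrr.
Qed.

Lemma size_recon (R : realType) (p : nat) (v : {poly R}) :
  (size v <= p.+1)%N -> (size (recon p v) <= p.+2)%N.
Proof.
move=> sv; rewrite /recon (leq_trans (size_polyD _ _)) // geq_max.
rewrite (leq_trans sv) //= size_polyN.
do 2!apply: (leq_trans (size_scale_leq _ _)).
rewrite (leq_trans (size_polyD _ _)) // size_polyN !size_legendre.
by rewrite geq_max leqnSn /=.
Qed.

Lemma size_deriv_leq (R : realType) (k : nat) (q : {poly R}) :
  (size q <= k.+1)%N -> (size (deriv q) <= k)%N.
Proof.
have [->|q0] := eqVneq q 0; first by rewrite poly.deriv0 size_poly0.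
by move=> sq; rewrite -ltnS (leq_trans (lt_size_deriv q0)).
Qed.

(** Integrate both sides by parts: the terms at 1 agree, those at -1 drop out on each side, and [v']
    has degree less than [p], so it is orthogonal to [L_p] and [L_(p+1)]. *)
Lemma polyint_deriv_recon (R : realType) (p : nat) (u v : {poly R}) :
  (size v <= p.+1)%N ->
  polyint (deriv (recon p u) * v) = polyint (deriv u * v) + u.[-1] * v.[-1].
Proof.
move=> sv.
have ibp (w : {poly R}) : polyint (deriv w * v) =
    w.[1] * v.[1] - w.[-1] * v.[-1] - polyint (w * deriv v).
  rewrite -!hornerM -[_.[1] - _]int11_deriv -/(polyint _) -linearB /=.
  by rewrite derivM addrK.
have ortho k : (p <= k)%N -> polyint (legendre R k * deriv v) = 0.
  by move=> pk; apply: legendre_ortho; rewrite (leq_trans _ pk) ?size_deriv_leq.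
rewrite !ibp recon1 reconN1 /recon.
set D := legendre R p - legendre R p.+1.
have D0 : polyint (D * deriv v) = 0.
  by rewrite mulrBl linearB /= !ortho ?subrr.
rewrite mulrBl linearB /= -!scalerAl.
rewrite 2!polyintZ D0 !mulr0.
by ring.
Qed.

(** * Algebra of matrix inner products and Young's inequality *)

Lemma ip_mulmxl (R : realType) (n : nat) (X K : 'M[R]_n) (x y : 'cV[R]_n) :
  ip X (K *m x) y = ip (K^T *m X) x y.
Proof. by rewrite /ip trmx_mul !mulmxA. Qed.

Lemma ip_mulmxr (R : realType) (n : nat) (X K : 'M[R]_n) (x y : 'cV[R]_n) :
  ip X x (K *m y) = ip (X *m K) x y.
Proof. by rewrite /ip !mulmxA. Qed.

Lemma ipZl (R : realType) (n : nat) (X : 'M[R]_n) (c : R) (x y : 'cV[R]_n) :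
  ip X (c *: x) y = c * ip X x y.
Proof. by rewrite /ip linearZ /= -!scalemxAl mxE. Qed.

Lemma ipZr (R : realType) (n : nat) (X : 'M[R]_n) (c : R) (x y : 'cV[R]_n) :
  ip X x (c *: y) = c * ip X x y.
Proof. by rewrite /ip -scalemxAr mxE. Qed.

Lemma ipBl (R : realType) (n : nat) (X : 'M[R]_n) (x y z : 'cV[R]_n) :
  ip X (x - y) z = ip X x z - ip X y z.
Proof. by rewrite /ip linearB /= !mulmxBl !mxE. Qed.

Lemma ipBr (R : realType) (n : nat) (X : 'M[R]_n) (x y z : 'cV[R]_n) :
  ip X x (y - z) = ip X x y - ip X x z.
Proof. by rewrite /ip mulmxBr !mxE. Qed.

Lemma ipDX (R : realType) (n : nat) (X Y : 'M[R]_n) (x y : 'cV[R]_n) :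
  ip (X + Y) x y = ip X x y + ip Y x y.
Proof. by rewrite /ip mulmxDr mulmxDl mxE. Qed.

Lemma ipZX (R : realType) (n : nat) (X : 'M[R]_n) (c : R) (x y : 'cV[R]_n) :
  ip (c *: X) x y = c * ip X x y.
Proof. by rewrite /ip -scalemxAr -scalemxAl mxE. Qed.

Lemma ipC (R : realType) (n : nat) (X : 'M[R]_n) (x y : 'cV[R]_n) :
  X^T = X -> ip X x y = ip X y x.
Proof.
move=> XT; rewrite /ip.
by have -> : x^T *m X *m y = (y^T *m X *m x)^T
  by [rewrite !trmx_mul trmxK XT mulmxA]; rewrite mxE.
Qed.

Lemma spd_ip_ge0 (R : realType) (n : nat) (X : 'M[R]_n) (x : 'cV[R]_n) :
  spd X -> 0 <= ip X x x.
Proof.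
move=> [_ Xpos]; have [->|x0] := eqVneq x 0; first by rewrite /ip mulmx0 mxE.
exact/ltW/Xpos.
Qed.

(** A vector in the left kernel has zero quadratic form, so definiteness makes it zero. *)
Lemma spd_unitmx (R : realType) (n : nat) (X : 'M[R]_n) :
  spd X -> X \in unitmx.
Proof.
move=> [XT Xpos]; rewrite -row_free_unit; apply/inj_row_free => v vX.
apply/eqP; apply: contraT => v0.
have := Xpos v^T; rewrite trmxK vX mul0mx mxE ltxx => ->//.
by rewrite -trmx0 (inj_eq trmx_inj).
Qed.

(* Expand the square [ip A z z >= 0] for [z = A^-1 M w - c v]. *)
Lemma ip_young (R : realType) (n : nat) (M A : 'M[R]_n) (c : R)
    (w v : 'cV[R]_n) :
  M^T = M -> spd A ->
  2 * c * ip M w v <= ip (M *m invmx A *m M) w w + c ^+ 2 * ip A v v.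
Proof.
move=> MT Aspd; have Au := spd_unitmx Aspd.
have := spd_ip_ge0 (invmx A *m M *m w - c *: v) Aspd.
have AT : A^T = A by case: Aspd.
have KT : (invmx A *m M)^T *m A = M.
  by rewrite trmx_mul trmx_inv AT MT mulmxKV.
have cross : ip A v (invmx A *m M *m w) = ip M w v.
  by rewrite ip_mulmxr mulmxA mulmxV // mul1mx ipC.
rewrite !(ipBl, ipBr, ipZl, ipZr) cross !ip_mulmxl KT ip_mulmxr mulmxA.
by rewrite expr2; lra.
Qed.

(** * Integrands of the matrix forms, kept as polynomials so that linearity of [polyint] applies *)

Definition polyip (R : realType) (n : nat) (X : 'M[R]_n) (u v : vpoly R n) :
    {poly R} :=
  (u^T *m map_mx (@polyC R) X *m v) 0 0.

Lemma horner_polyip (R : realType) (n : nat) (X : 'M[R]_n) (u v : vpoly R n)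
    (s : R) :
  (polyip X u v).[s] = ip X (veval u s) (veval v s).
Proof.
(* Evaluation at [s] is a ring morphism, so it commutes with matrix products. *)
have e : map_mx (horner_eval s) (u^T *m map_mx (@polyC R) X *m v) =
    (veval u s)^T *m X *m veval v s.
  rewrite !map_mxM -!map_trmx -map_mx_comp; congr (_ *m _ *m _).
  by apply/matrixP => i j; rewrite mxE /= /horner_eval hornerC.
by rewrite /ip -e mxE.
Qed.

(** Through this entrywise form, scalar facts such as [polyint_deriv_recon] and the product rule
    lift to vector-valued polynomials. *)
Lemma polyipE (R : realType) (n : nat) (X : 'M[R]_n) (u v : vpoly R n) :
  polyip X u v = \sum_i \sum_j X i j *: (u i 0 * v j 0).
Proof.
rewrite /polyip mxE exchange_big; apply: eq_bigr => j _ /=.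
rewrite mxE mulr_suml; apply: eq_bigr => i _.
by rewrite !mxE -mul_polyC; ring.
Qed.

Lemma polyint_polyip (R : realType) (n : nat) (X : 'M[R]_n) (u v : vpoly R n) :
  polyint (polyip X u v) = \sum_i \sum_j X i j * polyint (u i 0 * v j 0).
Proof.
rewrite polyipE linear_sum; apply: eq_bigr => i _.
by rewrite linear_sum; apply: eq_bigr => j _; rewrite -polyintZ.
Qed.

Lemma polyip_mxactr (R : realType) (n : nat) (X K : 'M[R]_n) (u v : vpoly R n) :
  polyip X u (mxact K v) = polyip (X *m K) u v.
Proof. by rewrite /polyip /mxact map_mxM !mulmxA. Qed.

Lemma polyipDr (R : realType) (n : nat) (X : 'M[R]_n) (u v w : vpoly R n) :
  polyip X u (v + w) = polyip X u v + polyip X u w.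
Proof. by rewrite /polyip mulmxDr mxE. Qed.

Lemma polyipZr (R : realType) (n : nat) (X : 'M[R]_n) (c : R) (u v : vpoly R n) :
  polyip X u (c%:P *: v) = c *: polyip X u v.
Proof. by rewrite /polyip -scalemxAr mxE mul_polyC. Qed.

Lemma polyipC (R : realType) (n : nat) (X : 'M[R]_n) (u v : vpoly R n) :
  X^T = X -> polyip X u v = polyip X v u.
Proof.
move=> XT; rewrite !polyipE exchange_big; apply: eq_bigr => i _.
by apply: eq_bigr => j _; rewrite -[in LHS]XT mxE mulrC.
Qed.

Lemma polyint_vrecon (R : realType) (n p : nat) (X : 'M[R]_n) (u v : vpoly R n) :
  (forall i, (size (v i 0%R) <= p.+1)%N) ->
  polyint (polyip X (vderiv (vrecon p u)) v) =
  polyint (polyip X (vderiv u) v) + ip X (veval u (-1)) (veval v (-1)).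
Proof.
move=> sv; rewrite -horner_polyip !polyint_polyip polyipE horner_sum -big_split.
apply: eq_bigr => i _; rewrite horner_sum -big_split; apply: eq_bigr => j _ /=.
by rewrite !mxE polyint_deriv_recon // hornerZ hornerM mulrDr.
Qed.

(* The left side is half of [|v(1)|^2 + |v(-1)|^2]. *)
Lemma polyint_vrecon_ge0 (R : realType) (n p : nat) (X : 'M[R]_n)
    (v : vpoly R n) :
  spd X -> (forall i, (size (v i 0%R) <= p.+1)%N) ->
  0 <= polyint (polyip X (vderiv (vrecon p v)) v).
Proof.
move=> Xspd sv; rewrite polyint_vrecon //.
have XT : X^T = X by case: Xspd.
have dq : deriv (polyip X v v) = polyip X (vderiv v) v + polyip X (vderiv v) v.
  rewrite [in X in _ = _ + X]polyipC // !polyipE raddf_sum -big_split.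
  apply: eq_bigr => i _; rewrite raddf_sum -big_split; apply: eq_bigr => j _ /=.
  by rewrite !mxE derivZ derivM scalerDr.
have := int11_deriv (polyip X v v).
rewrite -/(polyint _) dq linearD /= !horner_polyip => e.
have := spd_ip_ge0 (veval v 1) Xspd.
have := spd_ip_ge0 (veval v (-1)) Xspd.
by move: e; lra.
Qed.

(** * The form [Lform] on the diagonal *)

Lemma Bform_recon (R : realType) (n p : nat) (M A : 'M[R]_n) (tau : R)
    (u v : vpoly R n) :
  (forall i, (size (v i 0%R) <= p.+1)%N) ->
  Bform M A tau u v =
  polyint (polyip M (vderiv (vrecon p u)) v)
  + tau / 2 * polyint (polyip A u v).
Proof.
move=> sv; rewrite polyint_vrecon // /Bform.
by congr (int11 _ + _ + _ * int11 _); apply/funext => s; rewrite horner_polyip.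
Qed.

(** Reconstruction raises the degree by one and the derivative lowers it again. This admits [Pop v]
    as the second argument in [Bform_recon]. *)
Lemma size_Pop (R : realType) (n p : nat) (M A : 'M[R]_n) (tau : R)
    (v : vpoly R n) :
  (forall i, (size (v i 0%R) <= p.+1)%N) ->
  forall i, (size (Pop p M A tau v i 0%R) <= p.+1)%N.
Proof.
move=> sv i; rewrite !mxE (leq_trans (size_polyD _ _)) // geq_max.
apply/andP; split; last first.
  by rewrite mul_polyC (leq_trans (size_scale_leq _ _)).
apply: (leq_trans (size_sum _ _ _)); apply/bigmax_leqP => j _.
rewrite !mxE mul_polyC (leq_trans (size_scale_leq _ _)) //.
by apply: size_deriv_leq; apply: size_recon.
Qed.

(** The mixed terms [tau/2 (w, v)_M] and [tau/2 (v, A^-1 M w)_A] coincide, since [A A^-1 M = M] and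
    [M] is symmetric. *)
Lemma Lform_self (R : realType) (n p : nat) (M A : 'M[R]_n) (tau : R)
    (v : vpoly R n) :
  M^T = M -> spd A -> (forall i, (size (v i 0%R) <= p.+1)%N) ->
  let w := vderiv (vrecon p v) in
  Lform p M A tau v v =
  polyint (polyip (M *m invmx A *m M) w w) + tau * polyint (polyip M w v)
  + (tau / 2) ^+ 2 * polyint (polyip A v v).
Proof.
move=> MT Aspd sv w; rewrite /Lform (Bform_recon (p := p)); last exact: size_Pop.
rewrite /Pop -/w !polyipDr !polyip_mxactr !polyipZr !polyintD !polyintZ.
rewrite !mulmxA mulmxV ?spd_unitmx // mul1mx (polyipC v w MT).
by field.
Qed.

(** * Coordinates in a polynomial basis and the blocks of [Hmx] *)

Lemma polyint_polyip_vcomb (R : realType) (n p : nat) (X : 'M[R]_n)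
    (phi psi : 'I_p.+1 -> {poly R}) (x y : 'I_p.+1 -> 'cV[R]_n) :
  polyint (polyip X (vcomb phi x) (vcomb psi y)) =
  \sum_j \sum_k polyint (phi j * psi k) * ip X (x j) (y k).
Proof.
(* With the basis functions as scalars over [{poly R}], bilinearity splits off their Gram matrix. *)
have vcombE (f : 'I_p.+1 -> {poly R}) z :
    vcomb f z = \sum_j f j *: map_mx (@polyC R) (z j).
  apply: eq_bigr => j _; apply/matrixP => i k.
  by rewrite !mxE mulrC mul_polyC.
rewrite !vcombE /polyip [(\sum_j _)^T]linear_sum /= !mulmx_suml summxE linear_sum.
apply: eq_bigr => j _; rewrite mulmx_sumr summxE linear_sum; apply: eq_bigr => k _.
rewrite [(_ *: _)^T]linearZ /= -!scalemxAl -scalemxAr scalerA mxE.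
by rewrite map_trmx -!map_mxM mxE mulrC mul_polyC polyintZ mulrC.
Qed.

Lemma ip_shifted (R : realType) (n : nat) (M A : 'M[R]_n) (c : R) (x : 'cV[R]_n) :
  A \in unitmx ->
  ip ((M + c *: A) *m invmx A *m (M + c *: A)) x x =
  ip (M *m invmx A *m M) x x + 2 * c * ip M x x + c ^+ 2 * ip A x x.
Proof.
move=> Au.
have -> : (M + c *: A) *m invmx A *m (M + c *: A) =
    M *m invmx A *m M + (2 * c) *: M + c ^+ 2 *: A.
  rewrite mulmxDl -scalemxAl mulmxV // mulmxDl !mulmxDr -!scalemxAr mulmxKV //.
  rewrite -scalemxAl mul1mx -scalemxAl mul1mx scalerA -expr2.
  by rewrite mulr_natl mulr2n scalerDl !addrA.
by rewrite !ipDX !ipZX.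
Qed.

(** Squaring the shift [tau sqrt(lam j) / 2] leaves [lam j] itself on the [A] term, matching the
    mass matrix in the eigenbasis. *)
Lemma Hmx_quad (R : realType) (n p : nat) (M A : 'M[R]_n) (tau : R)
    (lam : 'I_p.+1 -> R) (x : 'I_p.+1 -> 'cV[R]_n) :
  A \in unitmx -> (forall j, 0 <= lam j) ->
  ((\mxcol_(j < p.+1) x j)^T *m Hmx M A tau lam *m \mxcol_(j < p.+1) x j) 0 0 =
  \sum_j (ip (M *m invmx A *m M) (x j) (x j)
    + tau * Num.sqrt (lam j) * ip M (x j) (x j)
    + (tau / 2) ^+ 2 * lam j * ip A (x j) (x j)).
Proof.
move=> Au lam0.
rewrite /Hmx -mulmxA mul_mxdiag_mxcol tr_mxcol mul_mxrow_mxcol summxE.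
apply: eq_bigr => j _; rewrite mulmxA -/(ip _ _ _) ip_shifted //.
have -> : (tau * Num.sqrt (lam j) / 2) ^+ 2 = (tau / 2) ^+ 2 * lam j.
  by rewrite mulrAC exprMn sqr_sqrtr.
by field.
Qed.

(** * Comparison of the two quadratic forms *)

Theorem theorem3p3 (R : realType) (p n : nat)
  (phi : 'I_p.+1 -> {poly_(p.+1) R}) (lam : 'I_p.+1 -> R)
  (phi_free : free (codom phi))
  (lam_gt0 : forall j, 0 < lam j)
  (phi_eigen : forall (j : 'I_p.+1) (v : {poly_(p.+1) R}),
    lam j * recon_ip p (phi j) v
    = int11 (fun s => (phi j : {poly R}).[s] * (v : {poly R}).[s]))
  (phi_normal : forall j k : 'I_p.+1,
    recon_ip p (phi j) (phi k) = (j == k)%:R)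
  (M A : 'M[R]_n) (tau : R)
  (M_spd : spd M) (A_spd : spd A) (tau_gt0 : 0 < tau)
  (L : 'M[R]_(\sum_(j < p.+1) n))
  (L_repr : represents M A tau (fun j => phi j : {poly R}) L)
  (v : 'cV[R]_(\sum_(j < p.+1) n)) (v_neq0 : v != 0) :
  1 / 2 <= (v^T *m L *m v) 0 0 / (v^T *m Hmx M A tau lam *m v) 0 0 <= 2.
Proof.
pose x j : 'cV[R]_n := submxcol v j.
have vE : v = \mxcol_(j < p.+1) x j by rewrite submxcolK.
have MT : M^T = M by case: M_spd.
have Au := spd_unitmx A_spd.
have lam_ge0 j : 0 <= lam j by apply: ltW.
have [j0 xj0] : exists j, x j != 0.
  apply/existsP; apply: contraNT v_neq0; rewrite negb_exists => /forallP x0.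
  rewrite vE -[X in _ == X](submxcolK (0 : 'cV[R]_(\sum_(j < p.+1) n))).
  apply/eqP/eq_mxcolP => j.
  by rewrite submxcol0; apply/eqP/negPn/x0.
set f := fun j => phi j : {poly R}.
pose u := vcomb f x.
have su i : (size (u i 0%R) <= p.+1)%N.
  rewrite /u /vcomb summxE; apply: (leq_trans (size_sum _ _ _)).
  apply/bigmax_leqP => j _; rewrite mxE.
  exact: leq_trans (size_scale_leq _ _) (size_npoly _).
pose w := vderiv (vrecon p u).
(* [w] keeps the coefficients of [u], now on the functions [(I phi_j)'], which [phi_normal] makes
   orthonormal. *)
have wE : w = vcomb (@deriv R \o (@recon R p \o f)) x.
  by rewrite /w /vrecon map_mx_vcomb /vderiv map_mx_vcomb.
have stiff : polyint (polyip (M *m invmx A *m M) w w) =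
    \sum_j ip (M *m invmx A *m M) (x j) (x j).
  rewrite wE polyint_polyip_vcomb; apply: eq_bigr => j _.
  have ortho k : polyint (deriv (recon p (f j)) * deriv (recon p (f k))) =
      (j == k)%:R.
    rewrite -phi_normal /recon_ip /polyint; congr (int11 _).
    by apply/funext => s; rewrite hornerM.
  rewrite (bigD1 j) //= ortho eqxx mul1r big1 ?addr0 // => k kj.
  by rewrite ortho eq_sym (negbTE kj) mul0r.
have mass : polyint (polyip A u u) = \sum_j lam j * ip A (x j) (x j).
  rewrite polyint_polyip_vcomb; apply: eq_bigr => j _.
  (* The eigenvalue equation tested with [phi k] diagonalizes the mass matrix. *)
  have ortho k : polyint (f j * f k) = lam j * (j == k)%:R.
    rewrite -phi_normal phi_eigen /polyint; congr (int11 _).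
    by apply/funext => s; rewrite hornerM.
  rewrite (bigD1 j) //= ortho eqxx mulr1 big1 ?addr0 // => k kj.
  by rewrite ortho eq_sym (negbTE kj) mulr0 mul0r.
have young : tau * polyint (polyip M w u) <=
    polyint (polyip (M *m invmx A *m M) w w)
    + (tau / 2) ^+ 2 * polyint (polyip A u u).
  (* The difference of the two sides is the integral of one polynomial, nonnegative at each [s] by
     [ip_young] with [c = tau / 2]. *)
  rewrite -subr_ge0 -!polyintZ -polyintD -[_ - _]linearB /=.
  apply: polyint_ge0 => s.
  rewrite hornerD hornerN hornerD !hornerZ !horner_polyip subr_ge0.
  have := ip_young (tau / 2) (veval w s) (veval u s) MT A_spd.
  by rewrite [2 * _]mulrC divfK ?pnatr_eq0.
have cross : 0 <= tau * polyint (polyip M w u).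
  by apply: mulr_ge0; [exact: ltW | exact: polyint_vrecon_ge0].
have -> : (v^T *m L *m v) 0 0 = Lform p M A tau u u by rewrite vE L_repr.
rewrite (Lform_self tau MT A_spd su) -/w vE Hmx_quad //.
set H := \sum_j _.
set E := polyint (polyip (M *m invmx A *m M) w w)
    + (tau / 2) ^+ 2 * polyint (polyip A u u) in young *.
have EE : E = \sum_j (ip (M *m invmx A *m M) (x j) (x j)
    + (tau / 2) ^+ 2 * lam j * ip A (x j) (x j)).
  rewrite /E stiff mass mulr_sumr -big_split.
  by apply: eq_bigr => j _; rewrite mulrA.
have EH : E <= H.
  rewrite EE; apply: ler_sum => j _; rewrite lerD2r lerDl.
  by rewrite !mulr_ge0 ?sqrtr_ge0 ?spd_ip_ge0 // ltW.
have HE : H <= 2 * E.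
  rewrite EE mulr_sumr; apply: ler_sum => j _.
  (* For this [c], [2 c] and [c^2] are the last two coefficients of block [j] of [H]. *)
  have := ip_young (tau / 2 * Num.sqrt (lam j)) (x j) (x j) MT A_spd.
  rewrite exprMn sqr_sqrtr // [2 * _]mulrA [2 * (tau / 2)]mulrC divfK ?pnatr_eq0 //.
  lra.
have stiff_ge0 y : 0 <= ip (M *m invmx A *m M) y y.
  (* Young's inequality with [c = 0] gives semidefiniteness without studying [A^-1]. *)
  have := ip_young 0 y 0 MT A_spd.
  by rewrite mulr0 mul0r expr0n mul0r addr0.
have E_gt0 : 0 < E.
  have mass_ge0 j : 0 <= (tau / 2) ^+ 2 * lam j * ip A (x j) (x j).
    apply: mulr_ge0; last exact: spd_ip_ge0.
    by apply: mulr_ge0 => //; exact: sqr_ge0.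
  rewrite EE (bigD1 j0) //= ltr_pwDl //; last first.
    by apply: sumr_ge0 => j _; rewrite addr_ge0.
  (* Strictness comes from the [A] term of the nonzero block [x j0]. *)
  rewrite ltr_wpDl // mulr_gt0 //; last by case: A_spd => _; apply.
  by rewrite mulr_gt0 // exprn_gt0 // divr_gt0.
have H_gt0 : 0 < H := lt_le_trans E_gt0 EH.
rewrite ler_pdivlMr // ler_pdivrMr //.
(* With [L] now [E] plus the cross term, [H / 2 <= E <= L <= 2 E <= 2 H]. *)
rewrite addrAC -/E.
by apply/andP; split; lra.
Qed.
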